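(* Let $N\ge1$, $T>0$, and let $J$ and $\mathcal{G}$ satisfy the assumptions stated in the context. Let $u$ and $v$ be, respectively, a subsolution and a supersolution of the Cauchy problem $$\begin{cases} u_t(x,t)=\displaystyle\int_{\mathbb{R}^N}J(x-y)\,u(y;x,t)\,\mathcal{G}(x,u(y;x,t))\,dy & \text{in }\mathbb{R}^N\times(0,T),\\ u(x,0)=u_0(x) & \text{in }\mathbb{R}^N,\end{cases}$$ with initial data $u_0\in\mathcal{C}(\mathbb{R}^N)\cap L^\infty(\mathbb{R}^N)$ and $v_0\in\mathcal{C}(\mathbb{R}^N)\cap L^\infty(\mathbb{R}^N)$, respectively, such that $u_0\le v_0$ in $\mathbb{R}^N$. Then $u\le v$ in $\mathbb{R}^N\times(0,T)$.
   Context: Notation: $u(y;x,t):=u(y,t)-u(x,t)$. Assumptions on $J$: $J:\mathbb{R}^N\to\mathbb{R}$ is a nonnegative radially symmetric function with $J\in\mathcal{C}_c(\mathbb{R}^N)$, $\int_{\mathbb{R}^N}J(z)\,dz=1$ and $C(J):=\int_{\mathbb{R}^N}J(z)z_N^2\,dz<\infty$. Assumptions on $\mathcal{G}$: $\mathcal{G}:\mathbb{R}^N\times\mathbb{R}\to\mathbb{R}$ is a nonnegative Carathéodory function ($\mathcal{G}(\cdot,s)$ measurable for every $s\in\mathbb{R}$, $\mathcal{G}(x,\cdot)$ continuous for a.e. $x\in\mathbb{R}^N$) and there exist constants $\alpha_2\ge\alpha_1>0$ such that $$\alpha_1\le\frac{\mathcal{G}(x,s)s-\mathcal{G}(x,\sigma)\sigma}{s-\sigma}\le\alpha_2\qquad\text{for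 all } s,\sigma\in\mathbb{R},\ s\neq\sigma,\ \text{and a.e. }x\in\mathbb{R}^N.$$ Subsolution with initial datum $u_0$: a function $u\in\mathcal{C}^0([0,T),\mathcal{C}(\mathbb{R}^N))\cap\mathcal{C}^1((0,T),\mathcal{C}(\mathbb{R}^N))$ with $u_t(x,t)\le\int_{\mathbb{R}^N}J(x-y)u(y;x,t)\mathcal{G}(x,u(y;x,t))\,dy$ in $\mathbb{R}^N\times(0,T)$ and $u(x,0)\le u_0(x)$ in $\mathbb{R}^N$. A supersolution is defined analogously, replacing ''$\le$'' by ''$\ge$''. *)

(* Defs.v *)
From HB Require Import structures.
From mathcomp Require Import all_boot all_order all_algebra.
From mathcomp Require Import all_classical all_reals all_analysis.
From mathcomp Require Import measurable_realfun.

Set Implicit Arguments.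
Unset Strict Implicit.
Unset Printing Implicit Defensive.
Import Order.TTheory GRing.Theory Num.Theory.
Import numFieldNormedType.Exports.
Local Open Scope classical_set_scope.
Local Open Scope ring_scope.

(* R^n is 'rV[R]_n, with its topology from the library and the product of the
   Borel sigma-algebras of the coordinates, which is the Borel
   sigma-algebra of R^n. *)
Definition rV_coord {R : realType} {n : nat} (i : 'I_n) (x : 'rV[R]_n) : R :=
  x ord0 i.

HB.instance Definition _ (R : realType) (n : nat) :=
  @isMeasurable.Build default_measure_display 'rV[R]_n
    (g_sigma_preimage (@rV_coord R n))
    (@sigma_algebra0 _ _ _) (@sigma_algebraC _ _) (@sigma_algebra_bigcup _ _ _).

Section lebesgue_measure_rV.
Context {R : realType}.

Lemma measurable_rV_coord n (i : 'I_n) :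
  measurable_fun [set: 'rV[R]_n] (rV_coord i).
Proof.
move=> _ Y mY; rewrite setTI; apply: sub_sigma_algebra => /=.
rewrite -bigcup_seq/=; exists i => /=; first by rewrite mem_index_enum.
by exists Y => //; rewrite setTI.
Qed.

Lemma measurable_fun_rV d (T : measurableType d) n (f : T -> 'rV[R]_n) :
  (forall i, measurable_fun [set: T] (fun x => f x ord0 i)) ->
  measurable_fun [set: T] f.
Proof.
move=> mf.
have sub : g_sigma_preimage (fun i => rV_coord i \o f) `<=` measurable.
  apply: smallest_sub; first exact: sigma_algebra_measurable.
  rewrite -bigcup_seq; apply: bigcup_sub => i _ A [B mB <-].
  exact: mf.
move=> _ A mA; apply: sub; rewrite g_sigma_preimage_comp.
by exists A.
Qed.

Definition rV_cons n (p : R * 'rV[R]_n) : 'rV[R]_n.+1 :=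
  \row_i oapp (p.2 ord0) p.1 (unlift ord0 i).

Definition rV_uncons n (x : 'rV[R]_n.+1) : R * 'rV[R]_n :=
  (x ord0 ord0, \row_i x ord0 (lift ord0 i)).

Lemma rV_cons0 n p : @rV_cons n p ord0 ord0 = p.1.
Proof. by rewrite mxE unlift_none. Qed.

Lemma rV_consS n p i : @rV_cons n p ord0 (lift ord0 i) = p.2 ord0 i.
Proof. by rewrite mxE liftK. Qed.

Lemma rV_consK n : cancel (@rV_cons n) (@rV_uncons n).
Proof.
move=> [r v]; rewrite /rV_uncons rV_cons0; congr pair.
by apply/rowP => i; rewrite mxE rV_consS.
Qed.

Lemma measurable_rV_cons n : measurable_fun [set: R * 'rV[R]_n] (@rV_cons n).
Proof.
apply: measurable_fun_rV => i; case: (unliftP ord0 i) => [j ->|->].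
  under eq_fun do rewrite rV_consS.
  by apply: (measurableT_comp (measurable_rV_coord j)); exact: measurable_snd.
by under eq_fun do rewrite rV_cons0; exact: measurable_fst.
Qed.

Lemma measurable_rV_uncons n :
  measurable_fun [set: 'rV[R]_n.+1] (@rV_uncons n).
Proof.
apply: measurable_fun_pair; first exact: measurable_rV_coord.
apply: measurable_fun_rV => i; under eq_fun do rewrite mxE.
exact: measurable_rV_coord.
Qed.

Definition rV_cons_measure n
    (m : {sigma_finite_measure set 'rV[R]_n -> \bar R}) :
    set 'rV[R]_n.+1 -> \bar R :=
  pushforward (@lebesgue_measure R \x m)%E (@rV_cons n).

Section rV_cons_measure_instance.
Variables (n : nat) (m : {sigma_finite_measure set 'rV[R]_n -> \bar R}).

Let mu0 : rV_cons_measure m set0 = 0%E.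
Proof. by rewrite /rV_cons_measure /pushforward preimage_set0 measure0. Qed.

Let mu_ge0 A : (0 <= rV_cons_measure m A)%E.
Proof. by rewrite /rV_cons_measure /pushforward; exact: measure_ge0. Qed.

Let mu_sigma_additive : semi_sigma_additive (rV_cons_measure m).
Proof.
have := @measure_semi_sigma_additive _ _ _
  (measure_function_pushforward__canonical__measure_function_Measure
     (@lebesgue_measure R \x m)%E (@measurable_rV_cons n)).
exact.
Qed.

HB.instance Definition _ := isMeasure.Build _ _ _
  (rV_cons_measure m) mu0 mu_ge0 mu_sigma_additive.

Let mu_sigma_finite : sigma_finite setT (rV_cons_measure m).
Proof.
have /sigma_finiteP[F [TF ndF Foo]] := sigma_finiteT (@lebesgue_measure R).
have /sigma_finiteP[G [TG ndG Goo]] := sigma_finiteT m.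
exists (fun k => @rV_uncons n @^-1` (F k `*` G k)).
  rewrite -preimage_bigcup -[LHS](preimage_setT (@rV_uncons n)); congr preimage.
  rewrite -setXTT TF TG predeqE => -[x y]; split.
    move=> [/= [i _ Fix] [j _ Gjy]]; exists (maxn i j) => //; split.
    - by move: x Fix; exact/subsetPset/ndF/leq_maxl.
    - by move: y Gjy; exact/subsetPset/ndG/leq_maxr.
  by move=> [i _ []/= ? ?]; split; exists i.
move=> k; have [mFk Fk] := Foo k; have [mGk Gk] := Goo k; split.
  rewrite -[_ @^-1` _]setTI; apply: measurable_rV_uncons => //.
  exact: measurableX.
rewrite /rV_cons_measure /pushforward -comp_preimage.
rewrite (_ : _ \o _ = id); last by apply/funext => x /=; rewrite rV_consK.
by rewrite product_measure1E// lte_mul_pinfty// ge0_fin_numE.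
Qed.

HB.instance Definition _ := Measure_isSigmaFinite.Build _ _ _
  (rV_cons_measure m) mu_sigma_finite.

End rV_cons_measure_instance.

Fixpoint lebesgue_rV (n : nat) : {sigma_finite_measure set 'rV[R]_n -> \bar R} :=
  match n with
  | 0 => \d_(0 : 'rV[R]_0)
  | k.+1 => rV_cons_measure (lebesgue_rV k)
  end.

(* This determines lebesgue_rV n: boxes form a sigma-finite generating
   pi-system. *)
Lemma lebesgue_rV_box n (A : 'I_n -> set R) : (forall i, measurable (A i)) ->
  lebesgue_rV n [set x | forall i, A i (x ord0 i)] =
  (\prod_(i < n) lebesgue_measure (A i))%E.
Proof.
elim: n A => [|n IH] A mA /=.
  rewrite big_ord0 diracE mem_set//=; by case.
rewrite big_ord_recl /= /rV_cons_measure /pushforward.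
rewrite (_ : _ @^-1` _ = A ord0 `*`
    [set x : 'rV[R]_n | forall i, A (lift ord0 i) (x ord0 i)]); last first.
  apply/seteqP; split => -[r v] /=.
    move=> H; split; first by have := H ord0; rewrite rV_cons0.
    by move=> i; have := H (lift ord0 i); rewrite rV_consS.
  move=> [Hr Hv] i; case: (unliftP ord0 i) => [j ->|->].
    by rewrite rV_consS; exact: Hv.
  by rewrite rV_cons0.
rewrite product_measure1E//; last first.
  rewrite [X in measurable X](_ : _ = \bigcap_(i in setT)
     (rV_coord i @^-1` A (lift ord0 i))); last first.
    by apply/seteqP; split => x /= H i; [move=> _|]; exact: H.
  apply: fin_bigcap_measurable => // i _.
  by rewrite -[_ @^-1` _]setTI; exact: measurable_rV_coord.
- exact: mA.
- by congr (_ * _)%E; exact: (IH (fun i => A (lift ord0 i))).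
Qed.

End lebesgue_measure_rV.
Arguments lebesgue_rV {R} n.

Section nonlocal_problem.
Context {R : realType}.

(* The norm that the library puts on 'rV[R]_n is the sup norm. *)
Definition enorm n (z : 'rV[R]_n) : R := Num.sqrt (\sum_(i < n) z ord0 i ^+ 2).

(* The dimension is n.+1, so that there is a last coordinate. *)
Record kernel_assumptions n (J : 'rV[R]_n.+1 -> R) : Prop := {
  kernel_ge0 : forall z, 0 <= J z ;
  kernel_radial : forall z z', enorm z = enorm z' -> J z = J z' ;
  kernel_continuous : continuous J ;
  kernel_compact_support : compact (closure [set z | J z != 0]) ;
  kernel_integral1 : (\int[lebesgue_rV n.+1]_z (J z)%:E = 1)%E ;
  kernel_second_moment :
    (\int[lebesgue_rV n.+1]_z (J z * z ord0 ord_max ^+ 2)%:E < +oo)%E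
}.

(* Measurability with respect to the Lebesgue sigma-algebra, i.e. the completion
   of the Borel sigma-algebra of R^n. *)
Definition lebesgue_measurable_fun n (f : 'rV[R]_n -> R) : Prop :=
  forall B : set R, measurable B ->
    completed_algebra_gen (lebesgue_rV n) (f @^-1` B).

Definition caratheodory_fun n (G : 'rV[R]_n -> R -> R) : Prop :=
  (forall s, lebesgue_measurable_fun (G ^~ s)) /\
  {ae lebesgue_rV n, forall x, continuous (G x)}.

Record coefficient_assumptions n (G : 'rV[R]_n -> R -> R) : Prop := {
  coefficient_ge0 : forall x s, 0 <= G x s ;
  coefficient_caratheodory : caratheodory_fun G ;
  coefficient_bounds : exists alpha1 alpha2 : R,
    [/\ 0 < alpha1, alpha1 <= alpha2 &
      forall s sigma : R, s != sigma ->
        {ae lebesgue_rV n, forall x,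
          alpha1 <= (G x s * s - G x sigma * sigma) / (s - sigma) <= alpha2}]
}.

Definition dt n (u : 'rV[R]_n -> R -> R) (x : 'rV[R]_n) (t : R) : R :=
  derive1 (u x) t.

(* u \in C^0([0,T), C(R^n)), where C(R^n) carries the topology of uniform
   convergence on R^n (the functions need not be bounded). Local uniform
   convergence would allow unbounded Tychonoff-type null solutions. *)
Definition C0_time n (T : R) (u : 'rV[R]_n -> R -> R) : Prop :=
  (forall t : R, t \in `[0, T[ -> continuous (u ^~ t)) /\
  {within `[0, T[,
    continuous (fun t : R => (u ^~ t) : {uniform 'rV[R]_n -> R})}.

(* u \in C^1((0,T), C(R^n)): the difference quotients in time converge in C(R^n),
   and the limit is a continuous curve in C(R^n). *)
Definition C1_time n (T : R) (u : 'rV[R]_n -> R -> R) : Prop :=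
  [/\ forall t : R, t \in `]0, T[ ->
        {uniform, (fun (h : R) x => h^-1 * (u x (t + h) - u x t)) @ 0^' -->
                  (dt u ^~ t)},
      forall t : R, t \in `]0, T[ -> continuous (dt u ^~ t) &
      {within `]0, T[,
        continuous (fun t : R => (dt u ^~ t) : {uniform 'rV[R]_n -> R})}].

Definition incr n (u : 'rV[R]_n -> R -> R) (y x : 'rV[R]_n) (t : R) : R :=
  u y t - u x t.

(* Finite for almost every x: for x outside a null set the integrand is bounded,
   continuous in y and compactly supported. *)
Definition nonlocal_operator n (J : 'rV[R]_n -> R) (G : 'rV[R]_n -> R -> R)
    (u : 'rV[R]_n -> R -> R) (x : 'rV[R]_n) (t : R) : \bar R :=
  (\int[lebesgue_rV n]_y (J (x - y) * incr u y x t * G x (incr u y x t))%:E)%E.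

Definition subsolution n (J : 'rV[R]_n -> R) (G : 'rV[R]_n -> R -> R) (T : R)
    (u0 : 'rV[R]_n -> R) (u : 'rV[R]_n -> R -> R) : Prop :=
  [/\ C0_time T u, C1_time T u,
      forall x (t : R), t \in `]0, T[ -> ((dt u x t)%:E <= nonlocal_operator J G u x t)%E &
      forall x, u x 0 <= u0 x].

Definition supersolution n (J : 'rV[R]_n -> R) (G : 'rV[R]_n -> R -> R) (T : R)
    (v0 : 'rV[R]_n -> R) (v : 'rV[R]_n -> R -> R) : Prop :=
  [/\ C0_time T v, C1_time T v,
      forall x (t : R), t \in `]0, T[ -> (nonlocal_operator J G v x t <= (dt v x t)%:E)%E &
      forall x, v0 x <= v x 0].

End nonlocal_problem.

(* Main.v *)
(* Put w = u - v and let M bound w(., t) from above. For almost every x the map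
   s |-> s G(x, s) is nondecreasing and alpha-Lipschitz, so subtracting the two
   inequalities at x gives
     w_t(x, t) <= alpha C (M - w(x, t)),
   where C bounds the integral of J(x - y) in y; both sides are continuous in x,
   hence this holds for every x. Thus (w - M) exp(alpha C t) is nonincreasing, and
   w <= 0 at time 0 yields w <= M (1 - exp(- alpha C b)) on [0, b]. Taking for M
   the supremum of w over [0, b] forces M <= 0. This supremum is finite because
   w(., 0) <= 0 and t |-> w(., t) is continuous for the uniform distance. *)
Require Import Defs.
From HB Require Import structures.
From mathcomp Require Import all_boot all_order all_algebra.
From mathcomp Require Import all_classical all_reals all_analysis.
From mathcomp Require Import lra measurable_realfun.

Import Order.TTheory GRing.Theory Num.Theory.
Import numFieldNormedType.Exports.
Local Open Scope classical_set_scope.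
Local Open Scope ring_scope.

(** * Differential inequalities in time, for one function and for families *)

Lemma differential_ineq_decay (R : realType) (f : R -> R) (b c M : R) :
  {within `[0, b], continuous f} ->
  (forall t : R, t \in `]0, b[ -> derivable f t 1) ->
  (forall t : R, t \in `]0, b[ -> derive1 f t <= c * (M - f t)) ->
  forall t : R, t \in `[0, b] -> (f t - M) * expR (c * t) <= f 0 - M.
Proof.
move=> cf df f'le t tb.
(* Integrating factor: [h' = (f' + c (f - M)) exp(c s)] is nonpositive by the hypothesis on [f']. *)
pose h s := (f s - M) * expR (c * s).
have dE (s : R) : is_derive s 1 (fun r => expR (c * r)) (c * expR (c * s)).
  have dc : is_derive s 1 (fun r : R => c * r) c.
    by apply: is_derive_eq; rewrite /= /GRing.scale /= mulr1.
  by rewrite mulrC; exact: (@is_derive1_comp R expR (fun r => c * r)).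
have dh (s : R) : s \in `]0, b[ ->
    is_derive s 1 h ((derive1 f s + c * (f s - M)) * expR (c * s)).
  move=> sb.
  have dfs : is_derive s 1 f (derive1 f s).
    by rewrite derive1E; apply/derivableP/df.
  apply: is_derive_eq; rewrite /= /GRing.scale /=; lra.
have h' (s : R) : s \in `]0, b[ -> derive1 h s <= 0.
  move=> sb; rewrite derive1E; have ? := dh _ sb; rewrite derive_val.
  rewrite pmulr_lle0 ?expR_gt0//; have := f'le _ sb; lra.
have ch : {within `[0, b], continuous h}.
  move=> s; apply: (@continuousM _ (subspace `[0, b]) (fun r => f r - M)
    (fun r => expR (c * r))).
    apply: (@continuousB _ R (subspace `[0, b]) f (cst M)); first exact: cf.
    exact: cst_continuous.
  apply: continuous_subspaceT => r.
  apply: differentiable_continuous.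
  by apply/derivable1_diffP; have [] := dE r.
have dh1 (s : R) : s \in `]0, b[ -> derivable h s 1 by move=> /dh[].
have t0 : 0 <= t by move: tb; rewrite in_itv/= => /andP[].
have b0 : 0 <= b by move: tb; rewrite in_itv/= => /andP[]; exact: le_trans.
have := @ler0_derive1_le_cc _ _ _ _ dh1 h' ch t 0 tb _ t0.
by rewrite /h mulr0 expR0 mulr1; apply; rewrite in_itv /= lexx.
Qed.

Section comparison_of_families.
Context {R : realType} {X : Type}.

(** Continuation argument: let [tau] be the supremum of the times up to which a bound uniform in [x]
    exists. Since [d] does not depend on [x], such a bound passes beyond [tau] unless [tau = b]. *)
Lemma equicontinuous_family_ubound (w : X -> R -> R) (T K : R) :
  (forall s : R, s \in `[0, T[ -> exists2 d, 0 < d &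
    forall (t : R) x, t \in `[0, T[ -> `|t - s| < d -> `|w x t - w x s| <= 1) ->
  (forall x, w x 0 <= K) ->
  forall b : R, b \in `[0, T[ ->
    exists M, forall (t : R) x, t \in `[0, b] -> w x t <= M.
Proof.
move=> wloc w0 b; rewrite in_itv/= => /andP[b0 bT].
pose A := [set a | 0 <= a <= b /\
  exists M, forall (t : R) x, t \in `[0, a] -> w x t <= M].
have A0 : A 0.
  split; first by rewrite lexx.
  exists K => t x; rewrite in_itv/= => /andP[t0 t0'].
  by have -> : t = 0 by lra.
have ubA : ubound A b by move=> a [/andP[]].
have supA : has_sup A by split; [exists 0|exists b].
set tau := sup A.
have tau0 : 0 <= tau by apply: ub_le_sup => //; exists b.
have taub : tau <= b by apply: ge_sup => //; exists 0.
have tauT : tau \in `[0, T[ by rewrite in_itv/=; apply/andP; split; lra.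
have [d d0 wd] := wloc _ tauT.
have [a [/andP[a0 ab] [M aM]] taua] := sup_adherent d0 supA.
have atau : a <= tau by apply: ub_le_sup; [exists b|split; [exact/andP|exists M]].
(* For [t] in []a, c]], both [a] and [t] are within [d] of [tau]; going from [a] to [t] through
   [tau] costs at most 1 + 1, hence the bound [M + 2]. *)
pose c := Num.min (tau + d / 2) b.
have cb : c <= b by rewrite /c ge_min lexx orbT.
have cd : c <= tau + d / 2 by rewrite /c ge_min lexx.
have c0 : 0 <= c by rewrite /c le_min b0 andbT; lra.
have Bc : forall (t : R) x, t \in `[0, c] -> w x t <= M + 2.
  move=> t x; rewrite in_itv/= => /andP[t0 tc].
  have [ta|ta] := leP t a.
    have := aM t x; rewrite in_itv/= t0 ta => /(_ isT); lra.
  have h1 : `|w x t - w x tau| <= 1.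
    apply: wd; first by rewrite in_itv/=; apply/andP; split; lra.
    by rewrite ltr_norml -/tau in taua *; apply/andP; split; lra.
  have h2 : `|w x a - w x tau| <= 1.
    apply: wd; first by rewrite in_itv/=; apply/andP; split; lra.
    by rewrite ltr_norml -/tau in taua *; apply/andP; split; lra.
  have := aM a x; rewrite in_itv/= a0 lexx => /(_ isT).
  move: h1 h2; rewrite !ler_norml => /andP[? ?] /andP[? ?]; lra.
(* As [tau + d / 2] exceeds [tau], this forces the minimum defining [c] to be [b]. *)
have ctau : c <= tau.
  apply: ub_le_sup; [by exists b|split; [exact/andP|by exists (M + 2)]].
exists (M + 2) => t x tb; apply: Bc.
suff -> : c = b by [].
move: ctau; rewrite /c; case: (leP (tau + d / 2) b) => //; lra.
Qed.

(** Isolates the time argument from the nonlocal operator, which enters only through the bound on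
    the derivative in terms of any [M] above [w] at time [t]. *)
Lemma differential_ineq_sup_le0 (w : X -> R -> R) (T c : R) : 0 <= c ->
  (forall s : R, s \in `[0, T[ -> exists2 d, 0 < d &
    forall (t : R) x, t \in `[0, T[ -> `|t - s| < d -> `|w x t - w x s| <= 1) ->
  (forall x, {within `[0, T[, continuous (w x)}) ->
  (forall x (t : R), t \in `]0, T[ -> derivable (w x) t 1) ->
  (forall M t : R, t \in `]0, T[ -> (forall y, w y t <= M) ->
    forall x, derive1 (w x) t <= c * (M - w x t)) ->
  (forall x, w x 0 <= 0) ->
  forall x (t : R), t \in `[0, T[ -> w x t <= 0.
Proof.
move=> c0 wloc wc wd w' w0 x0 b bT; rewrite leNgt; apply/negP => wb.
have [K wK] := @equicontinuous_family_ubound w T 0 wloc w0 b bT.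
have [b0 bT'] : 0 <= b /\ b < T by move: bT; rewrite in_itv/= => /andP[].
pose S := [set r | exists x t, t \in `[0, b] /\ r = w x t].
have Sb : S (w x0 b) by exists x0, b; rewrite in_itv /= lexx b0.
have ubS : ubound S K by move=> _ [x [t [tb ->]]]; exact: wK.
pose M := sup S.
have wM x (t : R) : t \in `[0, b] -> w x t <= M.
  by move=> tb; apply: ub_le_sup; [exists K|exists x, t].
have M0 : 0 < M by apply: (lt_le_trans wb); apply: wM; rewrite in_itv/= lexx b0.
have decay x (t : R) : t \in `[0, b] -> (w x t - M) * expR (c * t) <= - M.
  move=> tb; apply: (@le_trans _ _ (w x 0 - M)); last by have := w0 x; lra.
  apply: (@differential_ineq_decay R (w x) b c M) => //.
  - apply: continuous_subspaceW (wc x) => s /=; rewrite !in_itv/= => /andP[-> ?].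
    by apply: le_lt_trans bT'.
  - move=> s; rewrite in_itv/= => /andP[s0 sb]; apply: wd.
    by rewrite in_itv/= s0 (lt_trans sb).
  - move=> s; rewrite in_itv/= => /andP[s0 sb]; apply: w'.
      by rewrite in_itv/= s0 (lt_trans sb).
    by move=> y; apply: wM; rewrite in_itv/= !ltW.
pose E := expR (c * b).
have E0 : 0 < E by exact: expR_gt0.
have ME : 0 < M / E by exact: divr_gt0.
(* On [[0, b]], [exp(c t) <= E] because [0 <= c], so [decay] gives [w <= M - M / E]: an upper bound
   of [S] smaller than its supremum. *)
suff : M <= M - M / E by rewrite lerDl oppr_ge0 leNgt ME.
apply: ge_sup; first by exists (w x0 b).
move=> _ [x [t [tb ->]]].
have [t0 tb'] : 0 <= t /\ t <= b by move: tb; rewrite in_itv/= => /andP[].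
suff : M / E <= M - w x t by lra.
rewrite ler_pdivrMr //.
apply: (@le_trans _ _ ((M - w x t) * expR (c * t))).
  by rewrite -lerN2 -mulNr opprB; exact: decay.
rewrite ler_wpM2l ?subr_ge0 ?wM// ler_expR ler_wpM2l//.
Qed.

End comparison_of_families.

(** * Boxes, Borel sets and null sets of R^n *)

Lemma measurable_rV_prod {R : realType} {n} (A : 'I_n -> set R) :
  (forall i, measurable (A i)) ->
  measurable [set x : 'rV[R]_n | forall i, A i (x ord0 i)].
Proof.
move=> mA.
rewrite [X in measurable X](_ : _ = \bigcap_(i in setT) (rV_coord i @^-1` A i)).
  apply: fin_bigcap_measurable => // i _.
  by rewrite -[_ @^-1` _]setTI; exact: measurable_rV_coord.
by apply/seteqP; split => x /= H i; [move=> _|]; exact: H.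
Qed.

(** For [0 <= r], the closed ball of the sup norm, written by coordinates so that measure and
    compactness reduce to those of intervals. *)
Definition rV_box {R : realType} {n} (x : 'rV[R]_n) (r : R) : set 'rV[R]_n :=
  [set y | forall i, `[x ord0 i - r, x ord0 i + r]%classic (y ord0 i)].

Lemma measurable_rV_box {R : realType} {n} (x : 'rV[R]_n) r :
  measurable (rV_box x r).
Proof.
apply: (@measurable_rV_prod R n (fun i => `[x ord0 i - r, x ord0 i + r]%classic)) => i.
 exact: measurable_itv.
Qed.

Lemma compact_rV_box {R : realType} {n} (x : 'rV[R]_n) r : compact (rV_box x r).
Proof.
apply: (@rV_compact R n (fun i => `[x ord0 i - r, x ord0 i + r]%classic)) => i.
exact: segment_compact.
Qed.

Lemma rV_boxE {R : realType} {n} (x y : 'rV[R]_n) r :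
  rV_box x r y <-> forall i, `|x ord0 i - y ord0 i| <= r.
Proof.
split=> H i; have := H i; rewrite /= in_itv/= ler_norml => /andP[? ?];
  by apply/andP; split; lra.
Qed.

Lemma lebesgue_rV_rV_box {R : realType} {n} (x : 'rV[R]_n) r : 0 <= r ->
  lebesgue_rV n (rV_box x r) = ((2 * r) ^+ n)%:E.
Proof.
move=> r0.
rewrite (@lebesgue_rV_box R n (fun i => `[x ord0 i - r, x ord0 i + r]%classic))//.
under eq_bigr => i _.
  rewrite lebesgue_measure_itv/= lte_fin.
  (* The else branch forces [r = 0], where the default value 0 agrees with [2 * r]. *)
  have -> : (if x ord0 i - r < x ord0 i + r
             then ((x ord0 i + r)%:E - (x ord0 i - r)%:E)%E else 0%E)
            = (2 * r)%:E.
    case: ifPn => [_|]; first by rewrite -EFinB; congr EFin; lra.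
    by rewrite -leNgt => ?; congr EFin; lra.
  over.
by rewrite prodEFin prodr_const card_ord.
Qed.

Lemma nbhs_rV_box {R : realType} {n} (x : 'rV[R]_n) (A : set 'rV[R]_n) :
  nbhs x A -> exists2 r, 0 < r & rV_box x r `<=` A.
Proof.
move=> /nbhs_ballP[e /= e0 eA]; exists (e / 2); first exact: divr_gt0.
move=> y /rV_boxE xy; apply: eA; split => // i j; rewrite ord1.
by apply: le_lt_trans (xy j) _; lra.
Qed.

(** The sigma-algebra is generated by the coordinates, so open sets have to be recovered: [U] is the
    countable union of the boxes with rational centre and radius that it contains. *)
Lemma open_rV_measurable {R : realType} {n} (U : set 'rV[R]_n) :
  open U -> measurable U.
Proof.
move=> oU.
pose F (qk : 'rV[rat]_n * rat) : set 'rV[R]_n :=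
  let B := rV_box (map_mx ratr qk.1) (ratr qk.2) in
  if pselect (B `<=` U) then B else set0.
suff -> : U = \bigcup_qk F qk.
  apply: countable_bigcupT_measurable => [|qk]; first by apply: countableP.
  by rewrite /F; case: pselect => BU; [exact: measurable_rV_box|exact: measurable0].
apply/seteqP; split => [x Ux|x [qk _]]; last first.
  by rewrite /F; case: pselect => BU //; exact: BU.
have [r r0 rU] := nbhs_rV_box x U (open_nbhs_nbhs (conj oU Ux)).
(* With the centre within [k] of [x], each point of the rational box is within [2 k < r] of [x]. *)
have [k] := @rat_in_itvoo R 0 (r / 2) (divr_gt0 r0 (ltr0n _ 2)).
rewrite in_itv/= => /andP[k0 kr].
have near_rat i : exists q : rat, `|x ord0 i - ratr q| <= ratr k.
  have [|q] := @rat_in_itvoo R (x ord0 i - ratr k) (x ord0 i + ratr k); first lra.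
  rewrite in_itv/= => /andP[? ?]; exists q; rewrite ler_norml.
  by apply/andP; split; lra.
have [q xq] := choice near_rat.
have qx i : `|(map_mx ratr (\row_j q j) : 'rV[R]_n) ord0 i - x ord0 i| <= ratr k.
  by rewrite !mxE distrC.
exists (\row_i q i, k) => //; rewrite /F; case: pselect => [BU|[]].
  exact/rV_boxE.
move=> y /rV_boxE /= qy; apply: rU; apply/rV_boxE => i.
rewrite (le_trans (ler_distD ((map_mx ratr (\row_j q j) : 'rV[R]_n) ord0 i) _ _))//.
by have := qx i; have := qy i; rewrite (distrC (x ord0 i)); lra.
Qed.

Lemma continuous_rV_measurable {R : realType} {n} (f : 'rV[R]_n -> R) :
  continuous f -> measurable_fun setT f.
Proof.
move=> /continuousP cf; apply: (measurability _ (RGenOpens.measurableE R)).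
move=> _ [_ [a [b ->] <-]]; rewrite setTI.
by apply: open_rV_measurable; exact/cf/interval_open.
Qed.

(** A nonempty open set contains a box of positive measure, which no null set can cover. *)
Lemma ae_rV_dense {R : realType} {n} (P : set 'rV[R]_n) :
  {ae lebesgue_rV n, forall x, P x} -> dense P.
Proof.
move=> [N [mN N0 PN]] U [x Ux] oU.
have [r r0 rU] := nbhs_rV_box x U (open_nbhs_nbhs (conj oU Ux)).
have [y [rxy Ny]] : exists y, rV_box x r y /\ ~ N y.
  apply: contrapT => noy.
  have xN : rV_box x r `<=` N.
    by move=> y ry; apply: contrapT => Ny; apply: noy; exists y.
  have : (lebesgue_rV n (rV_box x r) <= lebesgue_rV n N)%E.
    by apply: le_measure; rewrite ?inE//; exact: measurable_rV_box.
  rewrite N0 (lebesgue_rV_rV_box _ _ (ltW r0)) lee_fin leNgt => /negP; apply.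
  by rewrite exprn_gt0// mulr_gt0.
exists y; split; first exact: rU.
by apply: contrapT => Py; apply: Ny; exact: PN.
Qed.

(** * Integrals of continuous functions vanishing outside a box *)

Section box_support.
Context {R : realType} {n : nat}.

Lemma rV_box_indic_integral (x : 'rV[R]_n) r : 0 <= r ->
  (\int[lebesgue_rV n]_y (\1_(rV_box x r) y)%:E = ((2 * r) ^+ n)%:E)%E.
Proof.
move=> r0; rewrite integral_indic ?setIT//; last exact: measurable_rV_box.
exact: lebesgue_rV_rV_box.
Qed.

Lemma rV_box_indic_integrable (x : 'rV[R]_n) r : 0 <= r ->
  (lebesgue_rV n).-integrable setT (fun y => (\1_(rV_box x r) y)%:E).
Proof.
move=> r0; have mB := measurable_rV_box x r; apply/integrableP; split.
  by apply/measurable_EFinP; exact: measurable_indic.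
under eq_integral do rewrite abse_EFin ger0_norm//.
by rewrite rV_box_indic_integral// ltry.
Qed.

Lemma box_support_integrable (f : 'rV[R]_n -> R) x r : 0 <= r ->
  continuous f -> (forall y, ~ rV_box x r y -> f y = 0) ->
  (lebesgue_rV n).-integrable setT (EFin \o f).
Proof.
move=> r0 cf f0.
have /compact_bounded[B [_ fB]] : compact (f @` rV_box x r).
  apply: continuous_compact; last exact: compact_rV_box.
  exact: continuous_subspaceT.
(* [compact_bounded] gives a bound by every real above [B]; [|B| + 1] is one, and it is positive. *)
have {}fB y : rV_box x r y -> `|f y| <= `|B| + 1.
  move=> ry; apply: (fB (`|B| + 1)); last by exists y.
  by rewrite (le_lt_trans (ler_norm B))// ltrDl.
apply: (@le_integrable _ _ _ _ _ measurableT _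
    (fun y => ((`|B| + 1)%:E * (\1_(rV_box x r) y)%:E)%E)).
- by apply/measurable_EFinP; exact: continuous_rV_measurable.
- move=> y _ /=; rewrite lee_fin indicE.
  have [/set_mem ry|/negP ry] := boolP (y \in rV_box x r).
    by rewrite mulr1 (le_trans (fB _ ry))// ler_norm.
  by rewrite f0 ?normr0// => /mem_set.
- by apply: integrableZl => //; exact: rV_box_indic_integrable.
Qed.

(* Bounds the integral of J (x - y) in y uniformly in x without appealing to the
   translation invariance of lebesgue_rV. *)
Lemma box_support_integral_le (f : 'rV[R]_n -> R) x r B : 0 <= r ->
  continuous f -> (forall y, ~ rV_box x r y -> f y = 0) ->
  (forall y, f y <= B) ->
  (\int[lebesgue_rV n]_y (f y)%:E <= (B * (2 * r) ^+ n)%:E)%E.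
Proof.
move=> r0 cf f0 fB.
have -> : ((B * (2 * r) ^+ n)%:E
    = \int[lebesgue_rV n]_y (B%:E * (\1_(rV_box x r) y)%:E))%E.
  rewrite integralZl//; last exact: rV_box_indic_integrable.
  by rewrite rV_box_indic_integral.
apply: le_integral => //.
- exact: (@box_support_integrable f x r).
- by apply: integrableZl => //; exact: rV_box_indic_integrable.
- move=> y _; rewrite lee_fin indicE.
  have [/set_mem ry|/negP ry] := boolP (y \in rV_box x r); first by rewrite mulr1.
  by rewrite f0 ?mulr0// => /mem_set.
Qed.

End box_support.

(** * Passing from rationals, dense sets and countable families to all points *)

Lemma continuous_rat_homo {R : realType} (f : R -> R) : continuous f ->
  (forall p q : rat, p < q -> f (ratr p) <= f (ratr q)) ->
  {homo f : x y / x <= y}.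
Proof.
move=> cf frat x y; rewrite le_eqVlt => /predU1P[->//|xy].
rewrite leNgt; apply/negP => fyx.
have e0 : 0 < (f x - f y) / 2 by lra.
have /cvgrPdist_lt/(_ _ e0)/nbhs_ballP[d1 /= d10 h1] := cf x.
have /cvgrPdist_lt/(_ _ e0)/nbhs_ballP[d2 /= d20 h2] := cf y.
(* [p] is taken just right of [x] and [q] just left of [y], with the midpoint between them; each
   moves [f] by less than half the gap [f x - f y], so [f q < f p]. *)
have [p] : exists p : rat, ratr p \in `]x, Num.min (x + d1) ((x + y) / 2)[.
  by apply: rat_in_itvoo; rewrite lt_min; apply/andP; split; lra.
rewrite in_itv/= lt_min => /and3P[xp pd1 pm].
have [q] : exists q : rat, ratr q \in `]Num.max (y - d2) ((x + y) / 2), y[.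
  by apply: rat_in_itvoo; rewrite gt_max; apply/andP; split; lra.
rewrite in_itv/= gt_max => /andP[/andP[qd2 qm] qy].
have pq : p < q by rewrite -(ltr_rat R); lra.
have fp : `|f x - f (ratr p)| < (f x - f y) / 2.
  by apply: h1; rewrite /ball /= ltr_norml; apply/andP; split; lra.
have fq : `|f y - f (ratr q)| < (f x - f y) / 2.
  by apply: h2; rewrite /ball /= ltr_norml; apply/andP; split; lra.
have := frat _ _ pq; move: fp fq; rewrite !ltr_norml => /andP[? ?] /andP[? ?]; lra.
Qed.

(** The set where [f - g > 0] is open, so one violation would produce another inside [P]. *)
Lemma dense_le {R : realType} {X : topologicalType} (f g : X -> R) (P : set X) :
  dense P -> continuous f -> continuous g ->
  (forall x, P x -> f x <= g x) -> forall x, f x <= g x.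
Proof.
move=> dP cf cg Pfg x; rewrite leNgt; apply/negP => gfx.
have [] := dP ((fun z => f z - g z) @^-1` [set r | 0 < r]).
- by exists x; rewrite /= subr_gt0.
- have cfg : continuous (fun z => f z - g z).
    by move=> z; apply: continuousB; [exact: cf|exact: cg].
  by move/continuousP: cfg; apply; exact: open_gt.
- by move=> z [/=]; rewrite subr_gt0 ltNge => /negP fg /Pfg.
Qed.

Lemma ae_countable {d} {T : measurableType d} {R : realType}
    (mu : {measure set T -> \bar R}) {I : countType} (P : I -> T -> Prop) :
  (forall i, {ae mu, forall x, P i x}) -> {ae mu, forall x, forall i, P i x}.
Proof.
move=> aeP.
(* Reindexing by [nat]; codes that decode to no index carry the trivial condition. *)
have : {ae mu, forall x, forall k, if unpickle k is Some i then P i x else True}.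
  apply: ae_foralln => k; case: (unpickle k) => [i|]; first exact: aeP.
  exact: aeW.
by apply: filterS => x Px i; have := Px (pickle i); rewrite pickleK.
Qed.

(** * Consequences of the assumptions on [G] and [J]; comparison of nonlocal operators *)

Section comparison.
Context {R : realType} {n : nat}.
Implicit Types (J : 'rV[R]_n.+1 -> R) (G u v : 'rV[R]_n.+1 -> R -> R).

(** In [coefficient_bounds] the null set may depend on the pair [s], [sigma]. The countably many
    rational pairs share one null set, and continuity of [G x] then reaches all real pairs. *)
Lemma coefficient_ae_monotone_lipschitz G : coefficient_assumptions G ->
  exists2 alpha : R, 0 < alpha & {ae lebesgue_rV n.+1, forall x,
    continuous (fun s : R => s * G x s) /\
    forall a b : R, a <= b -> 0 <= b * G x b - a * G x a <= alpha * (b - a)}.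
Proof.
move=> [_ [_ cG] [a1 [a2 [a10 a12 Gb]]]].
exists a2; first exact: lt_le_trans a12.
have aeG (pq : rat * rat) : {ae lebesgue_rV n.+1, forall x, pq.1 < pq.2 ->
    0 <= ratr pq.2 * G x (ratr pq.2) - ratr pq.1 * G x (ratr pq.1)
      <= a2 * (ratr pq.2 - ratr pq.1)}.
  case: pq => p q /=; have [pq|_] := boolP (p < q); last exact: aeW.
  have pq' : (ratr p : R) < ratr q by rewrite ltr_rat.
  have := Gb (ratr q) (ratr p); rewrite gt_eqF// => /(_ isT).
  apply: filterS => x /andP[h1 h2] _.
  have qp0 : 0 < (ratr q : R) - ratr p by rewrite subr_gt0.
  rewrite [ratr q * _]mulrC [ratr p * _]mulrC; apply/andP; split.
    have : 0 < (G x (ratr q) * ratr q - G x (ratr p) * ratr p) / (ratr q - ratr p).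
      exact: lt_le_trans h1.
    by rewrite pmulr_lgt0 ?invr_gt0//; exact: ltW.
  by rewrite -ler_pdivrMr.
apply: filterS2 cG (ae_countable _ _ aeG) => x cGx Gx.
have cg : continuous (fun s : R => s * G x s).
  by move=> s; apply: (@continuousM _ _ id (G x)); [exact: cvg_id|exact: cGx].
split=> // a b ab; apply/andP; split.
  rewrite subr_ge0.
  apply: (continuous_rat_homo (fun s : R => s * G x s) cg _ _ _ ab) => p q pq.
  by have /andP[] := Gx (p, q) pq; rewrite subr_ge0.
(* The upper bound is the monotonicity of [a2 * s - s * G x s], so the rational argument applies
   again. *)
suff : a2 * a - a * G x a <= a2 * b - b * G x b by rewrite mulrBr; lra.
apply: (continuous_rat_homo (fun s : R => a2 * s - s * G x s) _ _ _ _ ab)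
  => [s|p q pq].
  apply: (@continuousB _ _ _ (fun s : R => a2 * s) (fun s : R => s * G x s)).
    by apply: continuousM; [exact: cst_continuous|exact: cvg_id].
  exact: cg.
by have /andP[_] := Gx (p, q) pq; rewrite mulrBr /=; lra.
Qed.

(** The compact support is norm bounded, hence lies in a box; [J] is bounded there by continuity and
    vanishes elsewhere. *)
Lemma kernel_box_bounded J : kernel_assumptions J -> exists r B,
  [/\ 0 <= r, 0 <= B, forall z, J z <= B &
      forall x y, ~ rV_box x r y -> J (x - y) = 0].
Proof.
move=> [J0 _ cJ /compact_bounded[K [_ Kb]] _ _].
pose r := `|K| + 1.
have r0 : 0 <= r by rewrite addr_ge0.
have Jsupp x y : ~ rV_box x r y -> J (x - y) = 0.
  move=> nxy; apply: contrapT => /eqP Jxy; apply: nxy; apply/rV_boxE => i.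
  have xyr : `|x - y| <= r.
    apply: (Kb r); first by rewrite (le_lt_trans (ler_norm K))// ltrDl.
    exact: subset_closure.
  apply: le_trans xyr; rewrite -[leRHS]/(mx_norm (x - y)) mx_normrE.
  have -> : x ord0 i - y ord0 i = (x - y) ord0 i by rewrite !mxE.
  exact: (@le_bigmax _ _ _ 0 (fun ij => `|(x - y) ij.1 ij.2|) (ord0, i)).
have /compact_bounded[B [_ JB]] : compact (J @` rV_box 0 r).
  apply: continuous_compact; last exact: compact_rV_box.
  exact: continuous_subspaceT.
exists r, (`|B| + 1); split => //.
move=> z; have [zr|zr] := pselect (rV_box 0 r z); last first.
  (* [J z = J (0 - (- z))], and the box centred at 0 is symmetric. *)
  have [zr'|/Jsupp] := pselect (rV_box 0 r (- z)).
    exfalso; apply: zr; apply/rV_boxE => i; move/rV_boxE : zr' => /(_ i).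
    by rewrite !mxE !sub0r opprK normrN.
  by rewrite sub0r opprK => ->; rewrite addr_ge0.
apply: le_trans (ler_norm _) _.
apply: (JB (`|B| + 1)); last by exists z.
by rewrite (le_lt_trans (ler_norm B))// ltrDl.
Qed.

Lemma continuous_kernel_shift J (x : 'rV[R]_n.+1) :
  continuous J -> continuous (fun y : 'rV[R]_n.+1 => J (x - y)).
Proof.
move=> cJ y; apply: continuous_comp; last exact: cJ.
by apply: continuousB; [exact: cst_continuous|exact: cvg_id].
Qed.

(** The increments of [u] and [v] differ by at most [D = M - (u x t - v x t)], which is nonnegative
    (take [y = x]). If the increment of [u] is the smaller, monotonicity of [s * G x s] suffices;
    otherwise the Lipschitz bound gives [alpha * D]. Then integrate against [J (x - y)]. *)
Lemma nonlocal_operator_le J G u v x t (alpha C r M : R) : 0 <= alpha -> 0 <= r ->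
  continuous J -> (forall z, 0 <= J z) ->
  (forall y, ~ rV_box x r y -> J (x - y) = 0) ->
  (\int[lebesgue_rV n.+1]_y (J (x - y))%:E <= C%:E)%E ->
  continuous (u ^~ t) -> continuous (v ^~ t) ->
  continuous (fun s : R => s * G x s) ->
  (forall a b : R, a <= b -> 0 <= b * G x b - a * G x a <= alpha * (b - a)) ->
  (forall y, u y t - v y t <= M) ->
  (nonlocal_operator J G u x t <= nonlocal_operator J G v x t
     + (alpha * C * (M - (u x t - v x t)))%:E)%E.
Proof.
move=> alpha0 r0 cJ J0 Jr JC cu cv cg gP uvM.
pose D := M - (u x t - v x t).
have D0 : 0 <= D by rewrite subr_ge0.
have cJx := continuous_kernel_shift J x cJ.
have cF (w : 'rV[R]_n.+1 -> R -> R) : continuous (w ^~ t) ->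
    continuous (fun y : 'rV[R]_n.+1 => J (x - y) * incr w y x t * G x (incr w y x t)).
  move=> cw.
  (* Regrouping exhibits the product [s * G x s], whose continuity is [cg]. *)
  have -> : (fun y => J (x - y) * incr w y x t * G x (incr w y x t)) =
      (fun y => J (x - y) * (incr w y x t * G x (incr w y x t))).
    by apply/funext => y; rewrite mulrA.
  move=> y; apply: (@continuousM R 'rV[R]_n.+1 (fun y => J (x - y))
    (fun y => incr w y x t * G x (incr w y x t))); first exact: cJx.
  apply: (@continuous_comp _ _ _ (fun y => incr w y x t) (fun s : R => s * G x s)).
    by apply: (@continuousB _ _ _ (w ^~ t)); [exact: cw|exact: cst_continuous].
  exact: cg.
have iF (w : 'rV[R]_n.+1 -> R -> R) : continuous (w ^~ t) ->
    (lebesgue_rV n.+1).-integrable setT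
    (fun y => (J (x - y) * incr w y x t * G x (incr w y x t))%:E).
  move=> cw; apply: (@box_support_integrable _ _ _ x r) => //; first exact: cF.
  by move=> y /Jr ->; rewrite !mul0r.
have iJ : (lebesgue_rV n.+1).-integrable setT (fun y => (J (x - y))%:E).
  exact: (@box_support_integrable _ _ _ x r).
apply: (@le_trans _ _ (nonlocal_operator J G v x t +
    \int[lebesgue_rV n.+1]_y ((alpha * D)%:E * (J (x - y))%:E))%E); last first.
  rewrite leeD2l// integralZl// -/D mulrAC [leRHS]EFinM lee_wpmul2l// lee_fin.
  exact: mulr_ge0.
rewrite /nonlocal_operator -integralD//; [|exact: iF|exact: integrableZl].
apply: le_integral => //; [exact: iF| |].
  by apply: integrableD => //; [exact: iF|exact: integrableZl].
move=> y _; rewrite -EFinM -EFinD lee_fin -!mulrA [alpha * (D * _)]mulrA.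
rewrite [_ * J _]mulrC -mulrDr ler_wpM2l//.
have ab : incr u y x t - incr v y x t <= D by have := uvM y; rewrite /incr /D; lra.
have [le_ab|/ltW le_ba] := leP (incr u y x t) (incr v y x t).
  have /andP[h _] := gP _ _ le_ab; have := mulr_ge0 alpha0 D0; lra.
have /andP[_ h] := gP _ _ le_ba; have := ler_wpM2l alpha0 ab; lra.
Qed.

End comparison.

(** * Time regularity, uniform in space *)

Section uniform_time_regularity.
Context {R : realType}.

(** Stated for a general filter so as to serve both continuity in time and convergence of difference
    quotients. *)
Lemma uniform_cvg_dist_lt {X : choiceType} {I : Type} {F : set_system I}
    {FF : Filter F} (h : I -> X -> R) (f : X -> R) :
  {uniform, h @ F --> f} ->
  forall e, 0 < e -> \forall i \near F, forall x, `|f x - h i x| < e.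
Proof.
move=> hf e e0.
have : nbhs (f : {uniform X -> R}) [set g : X -> R | forall x, `|f x - g x| < e].
  apply/uniform_nbhs; exists [set p | ball p.1 e p.2]; split.
    by rewrite -entourage_ballE; exists e.
  by move=> g /= fg x; exact: fg.
by move/hf.
Qed.

Context {n : nat}.
Implicit Type u : 'rV[R]_n -> R -> R.

Lemma C0_time_dist_lt u T : C0_time T u -> forall s : R, s \in `[0, T[ ->
  forall e, 0 < e -> exists2 d, 0 < d &
    forall (t : R) x, t \in `[0, T[ -> `|t - s| < d -> `|u x t - u x s| < e.
Proof.
move=> [_ /subspace_continuousP cu] s sT e e0.
have /uniform_cvg_dist_lt/(_ e e0) := cu s sT.
move=> /nbhs_ballP[d /= d0 du]; exists d => // t x tT ts.
by rewrite distrC; apply: du => //; rewrite /ball/= distrC.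
Qed.

Lemma C0_time_within u T x : C0_time T u -> {within `[0, T[, continuous (u x)}.
Proof.
move=> uC0; apply/subspace_continuousP => s sT; apply/cvgrPdist_lt => e e0.
have [d d0 du] := C0_time_dist_lt _ _ uC0 s sT e e0.
apply/nbhs_ballP; exists d => //= t; rewrite /ball/= => st tT.
by rewrite distrC; apply: du => //; rewrite distrC.
Qed.

Lemma C1_time_derivable u T x t : C1_time T u -> t \in `]0, T[ ->
  derivable (u x) t 1.
Proof.
move=> [du _ _] tT; apply/cvg_ex; exists (dt u x t).
apply/cvgrPdist_lt => e e0.
have : \forall h \near 0^', forall y, `|dt u y t - h^-1 * (u y (t + h) - u y t)| < e.
  exact: (@uniform_cvg_dist_lt _ _ _ _ _ _ (du t tT)).
apply: filterS => h /(_ x) /=.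
by rewrite /GRing.scale/= mulr1 (addrC h t).
Qed.

End uniform_time_regularity.

Theorem theorem2p14 (R : realType) (n : nat) (T : R)
  (J : 'rV[R]_n.+1 -> R) (G : 'rV[R]_n.+1 -> R -> R)
  (u0 v0 : 'rV[R]_n.+1 -> R) (u v : 'rV[R]_n.+1 -> R -> R) :
  0 < T ->
  kernel_assumptions J -> coefficient_assumptions G ->
  continuous u0 -> u0 \in Lfun (lebesgue_rV n.+1) +oo%E ->
  continuous v0 -> v0 \in Lfun (lebesgue_rV n.+1) +oo%E ->
  (forall x, u0 x <= v0 x) ->
  subsolution J G T u0 u -> supersolution J G T v0 v ->
  forall x (t : R), t \in `]0, T[ -> u x t <= v x t.
Proof.
move=> T0 kJ cG _ _ _ _ uv0 [uC0 uC1 usub u_0] [vC0 vC1 vsup v_0] x t tT.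
have [alpha alpha0 aeG] := coefficient_ae_monotone_lipschitz G cG.
have [r [B [r0 B0 JB Jr]]] := kernel_box_bounded J kJ.
have [J0 _ cJ _ _ _] := kJ.
(* The bound of [J] times the volume of a box of half-side [r]: independent of the point [y]. *)
pose C := B * (2 * r) ^+ n.+1.
have C0 : 0 <= C by rewrite mulr_ge0// exprn_ge0// mulr_ge0.
have JC y : (\int[lebesgue_rV n.+1]_z (J (y - z))%:E <= C%:E)%E.
  apply: (@box_support_integral_le _ _ _ y) => //; last exact: Jr.
  exact: continuous_kernel_shift.
pose w y s := u y s - v y s.
have dw y s : s \in `]0, T[ -> is_derive s 1 (w y) (dt u y s - dt v y s).
  move=> sT.
  have ? : is_derive s 1 (u y) (dt u y s).
    by rewrite /dt derive1E; exact/derivableP/(C1_time_derivable u T).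
  have ? : is_derive s 1 (v y) (dt v y s).
    by rewrite /dt derive1E; exact/derivableP/(C1_time_derivable v T).
  exact: is_deriveB.
suff : w x t <= 0 by rewrite subr_le0.
apply: (@differential_ineq_sup_le0 _ _ w T (alpha * C)).
- by rewrite mulr_ge0// ltW.
(* Variation below 1/2 for each of [u] and [v] keeps that of [w] below 1. *)
- move=> s sT; have e0 : (0 : R) < 1 / 2 by lra.
  have [d1 d10 ud1] := C0_time_dist_lt u T uC0 s sT _ e0.
  have [d2 d20 vd2] := C0_time_dist_lt v T vC0 s sT _ e0.
  exists (Num.min d1 d2); first by rewrite lt_min d10.
  move=> s' y s'T; rewrite lt_min => /andP[s1 s2].
  have := ud1 s' y s'T s1; have := vd2 s' y s'T s2.
  rewrite /w !ltr_norml ler_norml => /andP[? ?] /andP[? ?].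
  by apply/andP; split; lra.
- move=> y s; apply: (@continuousB _ R (subspace `[0, T[) (u y) (v y)).
    exact: (C0_time_within u T y uC0).
  exact: (C0_time_within v T y vC0).
- by move=> y s /(dw y)[].
- move=> M s sT wM.
  have dwE y : derive1 (w y) s = dt u y s - dt v y s.
    by rewrite derive1E; have ? := dw y s sT; rewrite derive_val.
  have sT' : s \in `[0, T[.
    by move: sT; rewrite !in_itv/= => /andP[/ltW -> ->].
  have [cu cv] : continuous (u ^~ s) /\ continuous (v ^~ s).
    by split; [exact: (proj1 uC0)|exact: (proj1 vC0)].
  have [cdu cdv] : continuous (dt u ^~ s) /\ continuous (dt v ^~ s).
    by split; [case: uC1 => _ + _|case: vC1 => _ + _]; exact.
  (* The points where [G] is well behaved have full measure, hence are dense, and both sides are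
     continuous in space. *)
  apply: (dense_le _ _ _ (ae_rV_dense _ aeG)).
  + under eq_fun do rewrite dwE.
    move=> y; apply: (@continuousB _ _ _ (dt u ^~ s) (dt v ^~ s)).
      exact: cdu.
    exact: cdv.
  + move=> y; apply: (@continuousM _ _ (cst (alpha * C)) (fun z => M - w z s)).
      exact: cst_continuous.
    apply: (@continuousB _ _ _ (cst M) (w ^~ s)); first exact: cst_continuous.
    by apply: (@continuousB _ _ _ (u ^~ s) (v ^~ s)); [exact: cu|exact: cv].
  + move=> y [cg gP]; rewrite dwE -lee_fin.
    have Nuv := nonlocal_operator_le J G u v y s alpha C r M (ltW alpha0) r0 cJ
      J0 (Jr y) (JC y) cu cv cg gP wM.
    (* The chain runs in the extended reals; its two ends are finite, which brings it back to
       [R]. *)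
    have := le_trans (usub y s sT) (le_trans Nuv (leeD2r _ (vsup y s sT))).
    by rewrite -EFinD !lee_fin -/(w y s); lra.
- by move=> y; rewrite subr_le0 (le_trans (u_0 y))// (le_trans (uv0 y)).
- by move: tT; rewrite !in_itv/= => /andP[/ltW -> ->].
Qed.
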